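(* Let $P,Q$ be two $n\times n$ complex matrices and $\epsilon\in[0,1]$. Then $$\mathbf{ber}^2\left(\begin{bmatrix}0&P\\Q&0\end{bmatrix}\right)\leq\frac{1-\epsilon}{2}\max\left\{\mathbf{ber}^{\frac12}(|P|^2),\mathbf{ber}^{\frac12}(|Q|^2)\right\}\cdot\max\left\{\mathbf{ber}\big(|P|^2+Q(|Q|^2)^\dagger Q^*\big),\mathbf{ber}\big(|Q|^2+P(|P|^2)^\dagger P^*\big)\right\}+\epsilon\max\left\{\mathbf{ber}(|P|^2),\mathbf{ber}(|Q|^2)\right\}.$$
   Context: $T^*$ is the adjoint, $|T|=\sqrt{T^*T}$ (so $|T|^2=T^*T$), and $T^\dagger$ is the Moore–Penrose inverse. $\mathbb{C}^n$ with its standard inner product is regarded as a reproducing kernel Hilbert space of functions on $\{1,\dots,n\}$; its reproducing kernels are the standard basis vectors $e_1,\dots,e_n$. Thus for an $n\times n$ matrix $T$, the Berezin number is $\mathbf{ber}(T)=\max_{j}|\langle Te_j,e_j\rangle|$. The direct sum $\mathbb{C}^n\oplus\mathbb{C}^n$ is regarded as a reproducing kernel Hilbert space on the product set $\{1,\dots,n\}\times\{1,\dots,n\}$, the reproducing kernel at $(i,j)$ being $(e_i,e_j)$, with normalized kernel $\hat k_{(i,j)}=\frac{1}{\sqrt2}(e_i,e_j)$. For a $2\times2$ block matrix $M$ with $n\times n$ blocks, acting on $\mathbb{C}^n\oplus\mathbb{C}^n$, $\mathbf{ber}(M)=\max_{i,j}|\langle M\hat k_{(i,j)},\hat k_{(i,j)}\rangle|$.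 $\mathbf{ber}^p(T)$ means $(\mathbf{ber}(T))^p$. *)

(* Defs.v *)
From HB Require Import structures.
From mathcomp Require Import all_boot all_order all_algebra.
From mathcomp Require Import sesquilinear spectral complex.
From mathcomp Require Import classical_sets reals.

Set Implicit Arguments.
Unset Strict Implicit.
Unset Printing Implicit Defensive.

Import Order.TTheory GRing.Theory Num.Theory.

Local Open Scope ring_scope.
Local Open Scope sesquilinear_scope.

Section MatrixFunctions.
Variable C : numClosedFieldType.

(* Linear in the first argument: <x, y> = \sum_i x_i * conj (y_i). *)
Definition dotc m (x y : 'cV[C]_m) : C := (y^t* *m x) 0 0.

Definition psdmx n (A : 'M[C]_n) : Prop :=
  A^t* = A /\ forall x : 'cV[C]_n, 0 <= dotc (A *m x) x.

(* Functional calculus on a unitary diagonalization A = U^-1 diag(d) U. It is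
   the positive square root when A is positive semidefinite, and carries no
   meaning when A is not normal. *)
Definition sqrtmx n (A : 'M[C]_n) : 'M[C]_n :=
  invmx (spectralmx A) *m diag_mx (map_mx sqrtC (spectral_diag A))
    *m spectralmx A.

Definition absmx n (T : 'M[C]_n) : 'M[C]_n := sqrtmx (T^t* *m T).

Definition penrose m n (A : 'M[C]_(m, n)) (X : 'M[C]_(n, m)) : Prop :=
  [/\ A *m X *m A = A,
      X *m A *m X = X,
      (A *m X)^t* = A *m X &
      (X *m A)^t* = X *m A].

(* The default value 0 is never used: see [mpinvP] and [penrose_uniq]. *)
Definition mpinv m n (A : 'M[C]_(m, n)) : 'M[C]_(n, m) :=
  xget 0 (fun X => penrose A X).

Lemma adjM m n p (A : 'M[C]_(m, n)) (B : 'M[C]_(n, p)) :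
  (A *m B)^t* = B^t* *m A^t*.
Proof. by rewrite trmx_mul map_mxM. Qed.

Lemma dotc_ge0 m (x : 'cV[C]_m) : 0 <= dotc x x.
Proof.
rewrite /dotc mxE sumr_ge0 // => i _.
by rewrite !mxE mulrC mul_conjC_ge0.
Qed.

Lemma dotc_mul m n (A : 'M[C]_(m, n)) x y :
  dotc (A *m x) y = dotc x (A^t* *m y).
Proof. by rewrite /dotc adjM trmxCK mulmxA. Qed.

Lemma sqrtmx_sqr n (A : 'M[C]_n) : A \is normalmx ->
  sqrtmx A *m sqrtmx A = A.
Proof.
move=> /orthomx_spectralP eA; rewrite [RHS]eA /sqrtmx.
set U := spectralmx A; have uU : U \in unitmx by exact: spectral_unit.
rewrite -!mulmxA; congr (_ *m _); rewrite (mulmxA U) mulmxV // mul1mx.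
rewrite !mulmxA; congr (_ *m _); rewrite mulmx_diag; congr diag_mx.
by apply/rowP => i; rewrite !mxE -expr2 sqrtCK.
Qed.

Lemma psd_normal n (A : 'M[C]_n) : psdmx A -> A \is normalmx.
Proof. by case=> hA _; apply/normalmxP; rewrite hA. Qed.

Lemma psd_spectral_ge0 n (A : 'M[C]_n) i : psdmx A -> 0 <= spectral_diag A 0 i.
Proof.
move=> pA; have /orthomx_spectralP := psd_normal pA.
set U := spectralmx A; set d := spectral_diag A => eA.
have uU : U \is unitarymx by exact: spectral_unitarymx.
pose e : 'cV[C]_n := delta_mx i 0; have [_ /(_ (U^t* *m e))] := pA.
have -> : A *m (U^t* *m e) = U^t* *m (diag_mx d *m e).
  rewrite {1}eA invmx_unitary // -!mulmxA (mulmxA U) (unitarymxP uU).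
  by rewrite mul1mx.
rewrite dotc_mul trmxCK mulmxA (unitarymxP uU) mul1mx /dotc.
rewrite mul_diag_mx mxE (bigD1 i) //= big1.
  by rewrite !mxE !eqxx conjC1 mulr1 mul1r addr0.
by move=> j /negPf ji; rewrite !mxE ji conjC0 mul0r.
Qed.

Lemma sqrtmx_psd n (A : 'M[C]_n) : psdmx A -> psdmx (sqrtmx A).
Proof.
move=> pA; rewrite /sqrtmx; set U := spectralmx A.
have uU : U \is unitarymx by exact: spectral_unitarymx.
rewrite invmx_unitary //.
have s0 i : 0 <= sqrtC (spectral_diag A 0 i).
  by rewrite sqrtC_ge0 psd_spectral_ge0.
split.
  rewrite !adjM trmxCK tr_diag_mx map_diag_mx mulmxA; congr (_ *m diag_mx _ *m _).
  by apply/rowP => i; rewrite !mxE; apply/CrealP/ger0_real.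
move=> x; rewrite -!mulmxA dotc_mul trmxCK; move: (U *m x) => y.
rewrite /dotc mul_diag_mx mxE sumr_ge0 // => i _.
by rewrite !mxE mulrCA mulr_ge0 // mulrC mul_conjC_ge0.
Qed.

Lemma gram_psd n (T : 'M[C]_n) : psdmx (T^t* *m T).
Proof.
by split=> [|x]; rewrite ?adjM ?trmxCK // -mulmxA dotc_mul trmxCK dotc_ge0.
Qed.

Lemma absmx_psd n (T : 'M[C]_n) : psdmx (absmx T).
Proof. exact/sqrtmx_psd/gram_psd. Qed.

Lemma absmx_sqr n (T : 'M[C]_n) : absmx T *m absmx T = T^t* *m T.
Proof. exact/sqrtmx_sqr/psd_normal/gram_psd. Qed.

Lemma penrose_uniq m n (A : 'M[C]_(m, n)) X Y :
  penrose A X -> penrose A Y -> X = Y.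
Proof.
move=> [x1 x2 x3 x4] [y1 y2 y3 y4].
have e1 : A *m X = A *m Y.
  have h : A *m X = A *m Y *m (A *m X) by rewrite !mulmxA y1.
  by rewrite -x3 h adjM x3 y3 !mulmxA x1.
have e2 : X *m A = Y *m A.
  have h : X *m A = X *m A *m (Y *m A) by rewrite -!mulmxA (mulmxA A) y1.
  by rewrite -x4 h adjM x4 y4 -!mulmxA (mulmxA A) x1.
by rewrite -x2 e2 -mulmxA e1 mulmxA y2.
Qed.

Lemma row_free_gram m n (A : 'M[C]_(m, n)) :
  row_free A -> A *m A^t* \in unitmx.
Proof.
move=> fA; rewrite -row_free_unit; apply/inj_row_free => v h.
apply: (row_free_inj fA); rewrite mul0mx; apply/eqP.
rewrite -(dnorm_eq0 (@dotmx C n)) [X in X == 0]dotmxE adjM mulmxA -(mulmxA v) h.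
by rewrite mul0mx mxE.
Qed.

Lemma penrose_ex m n (A : 'M[C]_(m, n)) : exists X, penrose A X.
Proof.
have [r [F [G [-> freeF freeG]]]] : exists r, exists F : 'M[C]_(m, r),
    exists G : 'M[C]_(r, n), [/\ A = F *m G, row_free (F^t*) & row_free G].
  exists (\rank A), (col_base A), (row_base A).
  rewrite mulmx_base row_base_free; split=> //.
  by rewrite /row_free mxrank_map mxrank_tr; exact: col_base_full.
have uG := row_free_gram freeG.
have uF := row_free_gram freeF; rewrite trmxCK in uF.
pose g := G^t* *m invmx (G *m G^t*); pose f := invmx (F^t* *m F) *m F^t*.
have Gg : G *m g = 1%:M by rewrite mulmxA mulmxV.
have fF : f *m F = 1%:M by rewrite -mulmxA mulVmx.
have inv_herm k (B : 'M[C]_k) : B^t* = B -> (invmx B)^t* = invmx B.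
  by move=> hB; rewrite trmx_inv map_invmx hB.
have AX : F *m G *m (g *m f) = F *m f by rewrite -mulmxA (mulmxA G) Gg mul1mx.
have XA : g *m f *m (F *m G) = g *m G by rewrite -mulmxA (mulmxA f) fF mul1mx.
exists (g *m f); split; rewrite ?AX ?XA.
- by rewrite -mulmxA (mulmxA f) fF mul1mx.
- by rewrite -mulmxA (mulmxA G) Gg mul1mx.
- by rewrite !adjM trmxCK inv_herm ?mulmxA // adjM trmxCK.
- by rewrite !adjM trmxCK inv_herm ?mulmxA // adjM trmxCK.
Qed.

Lemma mpinvP m n (A : 'M[C]_(m, n)) : penrose A (mpinv A).
Proof. by apply: (@xgetPex _ 0 (fun X => penrose A X)); exact: penrose_ex. Qed.

End MatrixFunctions.

Section Berezin.
Variable R : realType.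

(* Berezin number with respect to a finite family k of normalized kernels.
   The values are nonnegative, so the starting value 0 does not change the
   maximum when the index type is inhabited. *)
Definition berezin m (I : finType) (k : I -> 'cV[R[i]]_m) (M : 'M[R[i]]_m) : R :=
  \big[Num.max/0]_(x : I) Normc.normc (dotc (M *m k x) (k x)).

Definition ber n (T : 'M[R[i]]_n) : R :=
  berezin (fun j : 'I_n => delta_mx j 0) T.

Definition ker_dsum n (x : 'I_n * 'I_n) : 'cV[R[i]]_(n + n) :=
  ((Num.sqrt 2)^-1 : R)%:C%C *: col_mx (delta_mx x.1 0) (delta_mx x.2 0).

Definition ber_dsum n (M : 'M[R[i]]_(n + n)) : R := berezin (@ker_dsum n) M.

End Berezin.

(* Main.v *)
Require Import Defs.
From mathcomp Require Import all_boot all_order all_algebra.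
From mathcomp Require Import sesquilinear spectral complex.
From mathcomp Require Import classical_sets reals.
From mathcomp Require Import ring lra.

Set Implicit Arguments.
Unset Strict Implicit.
Unset Printing Implicit Defensive.

Import Order.TTheory GRing.Theory Num.Theory.

Local Open Scope ring_scope.
Local Open Scope sesquilinear_scope.

(** Evaluated at the kernel with index (i, j), the block matrix gives
    (P i j + Q j i) / 2, so everything reduces to a bound on single entries.
    Let E_P = P (P^* P)^+ P^*, the orthogonal projection onto the range of P.
    Since E_P P = P, the entry P i j is the inner product of a row of E_P with
    a column of P, and Cauchy-Schwarz gives
      |P i j|^2 <= (E_P) i i * (P^* P) j j
    ([entry_le_range_proj]), where 0 <= (E_P) i i <= 1. The first factor is a
    diagonal entry of the projection term on the right-hand side, the second
    one of |P|^2; the same holds for Q j i with i and j exchanged.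

    Write a, b for the diagonal entries of |P|^2 at j and |Q|^2 at i, and u, v
    for those of E_P at i and E_Q at j. The entry bounds can be used in two
    ways. Dropping u and v shows that w = (|P i j| + |Q j i|) / 2 is at most
    s = max (sqrt (ber |P|^2)) (sqrt (ber |Q|^2)). The arithmetic-geometric
    inequality shows that 2 w <= (a + u + b + v) / 2 = ((a + v) + (b + u)) / 2,
    and a + v and b + u are diagonal entries of the two sums on the right-hand
    side, so w <= B / 2 where B is the maximum of their Berezin numbers. Hence
    w^2 <= s * (B / 2) and w^2 <= s^2, and the claim is the convex combination
    of these two bounds ([sqr_half_sum_le]). *)

(** * The projection onto the range of a matrix *)

Section RangeProjection.
Variables (C : numClosedFieldType) (m n : nat).
Implicit Types A : 'M[C]_(m, n).

Lemma gram_diag A j : (A^t* *m A) j j = \sum_k `|A k j| ^+ 2.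
Proof. by rewrite mxE; apply: eq_bigr => k _; rewrite !mxE normCKC. Qed.

Lemma gram_diag_ge0 A j : 0 <= (A^t* *m A) j j.
Proof. by rewrite gram_diag sumr_ge0 // => k _; exact: exprn_ge0. Qed.

Lemma gram_eq0 A : A^t* *m A = 0 -> A = 0.
Proof.
move=> A0; apply/matrixP => i j; have := gram_diag A j.
rewrite A0 !mxE => /esym/psumr_eq0P/(_ i) -/(_ _ isT)/eqP.
rewrite sqrf_eq0 normr_eq0 => h; apply/eqP/h => k _; exact: exprn_ge0.
Qed.

(** With G = A^* A, the difference D = A X G - A satisfies
    D^* D = (X G - 1)^* (G X G - G) = 0. *)
Lemma mulmx_penrose_gram A X : penrose (A^t* *m A) X -> A *m X *m (A^t* *m A) = A.
Proof.
move=> [GXG _ _ _]; apply/eqP; rewrite -subr_eq0; apply/eqP/gram_eq0.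
have -> : A *m X *m (A^t* *m A) - A = A *m (X *m (A^t* *m A) - 1%:M).
  by rewrite mulmxBr mulmx1 !mulmxA.
rewrite adjM -mulmxA.
have -> : A^t* *m (A *m (X *m (A^t* *m A) - 1%:M)) = 0.
  by rewrite mulmxA mulmxBr mulmx1 (mulmxA (A^t* *m A)) GXG subrr.
by rewrite mulmx0.
Qed.

Definition range_proj A : 'M[C]_m := A *m mpinv (A^t* *m A) *m A^t*.

Lemma range_projK A : range_proj A *m A = A.
Proof. by rewrite -mulmxA mulmx_penrose_gram //; exact: mpinvP. Qed.

(** This one identity says that [range_proj A] is both hermitian and idempotent;
    the diagonal entries are thereby the squared norms of the rows.
    It holds because the adjoint of A = A X A^* A rewrites A X A^* into its
    own adjoint A X^* A^*. *)
Lemma range_proj_mul_adj A : range_proj A *m (range_proj A)^t* = range_proj A.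
Proof.
set X := mpinv (A^t* *m A).
have eA : A *m X *m (A^t* *m A) = A by apply/mulmx_penrose_gram/mpinvP.
have eA' : A^t* = A^t* *m A *m (X^t* *m A^t*).
  by rewrite -{1}eA !adjM trmxCK.
rewrite {2}/range_proj -/X -(mulmxA A) !adjM trmxCK -mulmxA mulmxA range_projK.
by rewrite /range_proj -/X [in RHS]eA' (mulmxA (A *m X)) eA.
Qed.

Lemma range_proj_diag A i : range_proj A i i = \sum_k `|range_proj A i k| ^+ 2.
Proof.
by rewrite -{1}range_proj_mul_adj mxE; apply: eq_bigr => k _; rewrite !mxE normCK.
Qed.

Lemma range_proj_diag_ge0 A i : 0 <= range_proj A i i.
Proof. by rewrite range_proj_diag sumr_ge0 // => k _; exact: exprn_ge0. Qed.

(** A diagonal entry e is the squared norm of its row, which contains e itself,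
    so e^2 <= e. *)
Lemma range_proj_diag_le1 A i : range_proj A i i <= 1.
Proof.
have e0 := range_proj_diag_ge0 A i; have := range_proj_diag A i.
rewrite (bigD1 i) //= ger0_norm //.
move: (range_proj A i i) e0 => e e0 h; have : e * e <= e.
  by rewrite [leRHS]h -expr2 lerDl sumr_ge0 // => k _; exact: exprn_ge0.
move: e0; rewrite le_eqVlt => /predU1P[<- _|e0]; first exact: ler01.
by rewrite ger_pMr.
Qed.

End RangeProjection.

Lemma Cauchy_Schwarz_mulmx (C : numClosedFieldType) m n p
    (A : 'M[C]_(m, n)) (B : 'M[C]_(n, p)) i j :
  `|(A *m B) i j| ^+ 2 <= (\sum_k `|A i k| ^+ 2) * (\sum_k `|B k j| ^+ 2).
Proof.
have CS (u v : 'rV[C]_n) : `|dotmx u v| ^+ 2 <= dotmx u u * dotmx v v.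
  by have [] := CauchySchwarz (@dotmx C n) u v.
have dotE (u v : 'rV[C]_n) : dotmx u v = \sum_k u 0 k * (v 0 k)^*.
  by rewrite dotmxE mxE; apply: eq_bigr => k _; rewrite !mxE.
have := CS (row i A) ((col j B)^t*); rewrite !dotE mxE.
under eq_bigr do rewrite !mxE conjCK.
under [X in _ <= X * _ -> _]eq_bigr do rewrite !mxE -normCK.
by under [X in _ <= _ * X -> _]eq_bigr do rewrite !mxE conjCK -normCKC.
Qed.

(** Cauchy-Schwarz for the product [range_proj A *m A], which is [A]. *)
Lemma entry_le_range_proj (C : numClosedFieldType) m n (A : 'M[C]_(m, n)) i j :
  `|A i j| ^+ 2 <= range_proj A i i * (A^t* *m A) j j.
Proof.
rewrite -{1}(range_projK A) range_proj_diag gram_diag.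
exact: Cauchy_Schwarz_mulmx.
Qed.

(** * Quadratic forms at the kernels *)

Section DotProduct.
Variable C : numClosedFieldType.

Lemma dotc_delta m n (M : 'M[C]_(m, n)) i j :
  dotc (M *m delta_mx j 0) (delta_mx i 0) = M i j.
Proof. by rewrite /dotc trmx_delta map_delta_mx -colE -rowE !mxE. Qed.

Lemma dotcZ m (M : 'M[C]_m) (c : C) (x : 'cV[C]_m) :
  dotc (M *m (c *: x)) (c *: x) = c * c^* * dotc (M *m x) x.
Proof.
by rewrite /dotc linearZ /= map_mxZ -!scalemxAr -scalemxAl !mxE mulrA.
Qed.

Lemma dotc_col_mx m n (a c : 'cV[C]_m) (b d : 'cV[C]_n) :
  dotc (col_mx a b) (col_mx c d) = dotc a c + dotc b d.
Proof. by rewrite /dotc tr_col_mx map_row_mx mul_row_col mxE. Qed.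

End DotProduct.

(** * The scalar inequality *)

(** Each of x and y is at most s because u, v <= 1, and 2 x <= a + u and
    2 y <= b + v because (2 x)^2 <= 4 u a <= (a + u)^2. Regrouping a + u + b + v
    as (a + v) + (b + u) brings in B. *)
Lemma sqr_half_sum_le (R : realFieldType) (x y a b u v s B e : R) :
    0 <= x -> 0 <= y -> 0 <= a -> 0 <= b -> 0 <= u <= 1 -> 0 <= v <= 1 ->
    0 <= s -> 0 <= e <= 1 ->
    x ^+ 2 <= u * a -> y ^+ 2 <= v * b -> a <= s ^+ 2 -> b <= s ^+ 2 ->
    a + v <= B -> b + u <= B ->
  ((x + y) / 2) ^+ 2 <= (1 - e) / 2 * s * B + e * s ^+ 2.
Proof.
move=> x0 y0 a0 b0 /andP[u0 u1] /andP[v0 v1] s0 /andP[e0 e1] xua yvb asq bsq avB buB.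
have sqle (t c d : R) : 0 <= t -> 0 <= c -> 0 <= d <= 1 -> c <= s ^+ 2 ->
    t ^+ 2 <= d * c -> t <= s /\ 2 * t <= c + d.
  move=> t0 c0 /andP[d0 d1] cs tdc; split.
    rewrite -ler_sqr ?nnegrE // (le_trans tdc) // (le_trans _ cs) //.
    by rewrite ler_piMl.
  rewrite -ler_sqr ?nnegrE ?addr_ge0 ?mulr_ge0 //.
  by have := sqr_ge0 (c - d); nra.
have [xs xau] : x <= s /\ 2 * x <= a + u by apply: sqle => //; rewrite u0.
have [ys ybv] : y <= s /\ 2 * y <= b + v by apply: sqle => //; rewrite v0.
set w := (x + y) / 2.
have w0 : 0 <= w by rewrite /w; lra.
have ws : w <= s by rewrite /w; lra.
have wB : w <= B / 2 by rewrite /w; lra.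
(* One factor w is bounded by s, the other by B / 2. *)
have wsB : w ^+ 2 <= s * (B / 2) by rewrite expr2 ler_pM.
have wss : w ^+ 2 <= s ^+ 2 by rewrite ler_sqr ?nnegrE.
have -> : (1 - e) / 2 * s * B + e * s ^+ 2 = (1 - e) * (s * (B / 2)) + e * s ^+ 2 by ring.
(* Split w^2 with the weights 1 - e and e. *)
rewrite -[leLHS]mul1r -{1}(subrK e 1) mulrDl lerD // ler_wpM2l //.
by rewrite subr_ge0.
Qed.

Lemma max_sqrt_sqr (R : rcfType) (a b : R) : 0 <= a -> 0 <= b ->
  Num.max (Num.sqrt a) (Num.sqrt b) ^+ 2 = Num.max a b.
Proof.
move=> a0 b0; case: (leP a b) => [h|/ltW h].
  by rewrite (max_idPr _) ?ler_wsqrtr // sqr_sqrtr.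
by rewrite (max_idPl _) ?ler_wsqrtr // sqr_sqrtr.
Qed.

(** For a maximum over an empty family of kernels, which is 0, the nonnegativity
    of the bound is all there is to prove. *)
Lemma interpolated_max_ge0 (R : rcfType) (al be B1 B2 e : R) :
  0 <= e <= 1 -> 0 <= al -> 0 <= B1 ->
  0 <= (1 - e) / 2 * Num.max (Num.sqrt al) (Num.sqrt be) * Num.max B1 B2
    + e * Num.max al be.
Proof.
case/andP=> e0 e1 al0 B10.
apply: addr_ge0; apply: mulr_ge0; rewrite ?le_max ?al0 ?B10 //.
apply: mulr_ge0; first by rewrite divr_ge0 ?subr_ge0.
by rewrite le_max sqrtr_ge0.
Qed.

(** [sqr_half_sum_le] with s^2 and B taken to be maxima: [al], [be], [B1], [B2]
    stand for the four Berezin numbers of the bound. *)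
Lemma sqr_half_sum_le_max (R : rcfType) (x y a b u v al be B1 B2 e : R) :
    0 <= x -> 0 <= y -> 0 <= a -> 0 <= b -> 0 <= u <= 1 -> 0 <= v <= 1 ->
    0 <= e <= 1 -> x ^+ 2 <= u * a -> y ^+ 2 <= v * b ->
    a <= al -> b <= be -> a + v <= B1 -> b + u <= B2 ->
  ((x + y) / 2) ^+ 2 <=
    (1 - e) / 2 * Num.max (Num.sqrt al) (Num.sqrt be) * Num.max B1 B2
    + e * Num.max al be.
Proof.
move=> x0 y0 a0 b0 u01 v01 e01 xua yvb aal bbe avB1 buB2.
have s2 := max_sqrt_sqr (le_trans a0 aal) (le_trans b0 bbe).
rewrite -s2; apply: (@sqr_half_sum_le _ x y a b u v) => //.
- by rewrite le_max sqrtr_ge0.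
- by rewrite s2 le_max aal.
- by rewrite s2 le_max bbe orbT.
- by rewrite le_max avB1.
- by rewrite le_max buB2 orbT.
Qed.

(** * Berezin numbers *)

Section Berezin.
Variable R : realType.

Lemma normc_ge0 (z : R[i]) : 0 <= Normc.normc z.
Proof. by case: z => x y; exact: sqrtr_ge0. Qed.

Lemma normC_normc (z : R[i]) : `|z| = (Normc.normc z)%:C%C.
Proof. by case: z => x y; rewrite normc_def. Qed.

Lemma ler_normc (y z : R[i]) : 0 <= y -> y <= z -> Normc.normc y <= Normc.normc z.
Proof.
move=> y0 yz; have z0 := le_trans y0 yz.
by rewrite -lecR -!normC_normc !ger0_norm.
Qed.

Lemma normcD_ge0 (y z : R[i]) : 0 <= y -> 0 <= z ->
  Normc.normc (y + z) = Normc.normc y + Normc.normc z.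
Proof.
move=> y0 z0; apply: complexI.
by rewrite rmorphD /= -!normC_normc !ger0_norm ?addr_ge0.
Qed.

Lemma berezin_ge0 m (I : finType) (k : I -> 'cV[R[i]]_m) (M : 'M[R[i]]_m) :
  0 <= berezin k M.
Proof.
rewrite /berezin; elim/big_ind: _ => // [x y x0 _|i _]; first by rewrite le_max x0.
exact: normc_ge0.
Qed.

Lemma sqr_berezin_le m (I : finType) (k : I -> 'cV[R[i]]_m) (M : 'M[R[i]]_m) c :
  0 <= c -> (forall x, Normc.normc (dotc (M *m k x) (k x)) ^+ 2 <= c) ->
  berezin k M ^+ 2 <= c.
Proof.
move=> c0 kle; rewrite -(sqr_sqrtr c0) ler_sqr ?nnegrE ?sqrtr_ge0 ?berezin_ge0 //.
apply/bigmax_leP; split=> [|x _]; first exact: sqrtr_ge0.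
by rewrite -ler_sqr ?nnegrE ?sqrtr_ge0 ?normc_ge0 // sqr_sqrtr.
Qed.

Lemma normc_diag_le_ber n (T : 'M[R[i]]_n) j : Normc.normc (T j j) <= ber T.
Proof.
rewrite -dotc_delta.
exact: (le_bigmax 0 (fun j => Normc.normc (dotc (T *m delta_mx j 0) (delta_mx j 0)))).
Qed.

Lemma dotc_ker_dsum n (P Q : 'M[R[i]]_n) x :
  dotc (block_mx 0 P Q 0 *m ker_dsum R x) (ker_dsum R x) = (P x.1 x.2 + Q x.2 x.1) / 2.
Proof.
rewrite /ker_dsum; set c := (_%:C)%C.
have cc : c * c^* = 2^-1.
  have -> : c^* = c by exact: conjc_real.
  rewrite /c -rmorphM /= -invfM -expr2 sqr_sqrtr ?ler0n //.
  by rewrite fmorphV rmorph_nat.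
rewrite dotcZ mul_block_col !mul0mx add0r addr0 dotc_col_mx !dotc_delta.
by rewrite cc mulrC.
Qed.

Lemma normc_entry_sqr_le n (T : 'M[R[i]]_n) k l :
  Normc.normc (T k l) ^+ 2 <=
    Normc.normc (range_proj T k k) * Normc.normc ((T^t* *m T) l l).
Proof.
rewrite -lecR rmorphXn rmorphM /= -!normC_normc.
rewrite (ger0_norm (range_proj_diag_ge0 T k)) (ger0_norm (gram_diag_ge0 T l)).
exact: entry_le_range_proj.
Qed.

Lemma normc_range_proj01 n (T : 'M[R[i]]_n) k :
  0 <= Normc.normc (range_proj T k k) <= 1.
Proof.
apply/andP; split; first exact: normc_ge0.
rewrite -[leRHS](Normc.normc1 R); apply: ler_normc.
- exact: range_proj_diag_ge0.
- exact: range_proj_diag_le1.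
Qed.

Lemma gram_range_proj_le_ber n (S T : 'M[R[i]]_n) k :
  Normc.normc ((S^t* *m S) k k) + Normc.normc (range_proj T k k)
  <= ber (S^t* *m S + range_proj T).
Proof.
rewrite -(normcD_ge0 (gram_diag_ge0 S k) (range_proj_diag_ge0 T k)).
by have := normc_diag_le_ber (S^t* *m S + range_proj T) k; rewrite [X in Normc.normc X]mxE.
Qed.

Lemma normc_half_sum_le (y z : R[i]) :
  Normc.normc ((y + z) / 2) <= (Normc.normc y + Normc.normc z) / 2.
Proof.
rewrite -lecR rmorphM rmorphD fmorphV rmorph_nat /= -!normC_normc.
by rewrite normrM normfV normr_nat ler_wpM2r ?invr_ge0 // ler_normD.
Qed.

Lemma ber_dsum_antidiag_le (n : nat) (P Q : 'M[R[i]]_n) (eps : R) :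
  0 <= eps <= 1 ->
  ber_dsum (block_mx 0 P Q 0) ^+ 2 <=
    (1 - eps) / 2
      * Num.max (Num.sqrt (ber (P^t* *m P))) (Num.sqrt (ber (Q^t* *m Q)))
      * Num.max (ber (P^t* *m P + range_proj Q)) (ber (Q^t* *m Q + range_proj P))
    + eps * Num.max (ber (P^t* *m P)) (ber (Q^t* *m Q)).
Proof.
move=> eps01; apply: sqr_berezin_le => [|[i j]].
  exact: (interpolated_max_ge0 _ _ eps01 (berezin_ge0 _ _) (berezin_ge0 _ _)).
rewrite (dotc_ker_dsum P Q (i, j)) /=.
apply: (@le_trans _ _ (((Normc.normc (P i j) + Normc.normc (Q j i)) / 2) ^+ 2)).
  rewrite ler_sqr ?nnegrE; first exact: normc_half_sum_le.
    exact: normc_ge0.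
  by rewrite divr_ge0 ?addr_ge0 ?normc_ge0.
exact: (sqr_half_sum_le_max (normc_ge0 _) (normc_ge0 _) (normc_ge0 _)
  (normc_ge0 _) (normc_range_proj01 P i) (normc_range_proj01 Q j) eps01
  (normc_entry_sqr_le P i j) (normc_entry_sqr_le Q j i)
  (normc_diag_le_ber _ j) (normc_diag_le_ber _ i)
  (gram_range_proj_le_ber P Q j) (gram_range_proj_le_ber Q P i)).
Qed.

End Berezin.

Theorem corollary2p5 (R : realType) (n : nat) (P Q : 'M[R[i]]_n) (eps : R)
    (eps01 : 0 <= eps <= 1) :
  ber_dsum (block_mx 0 P Q 0) ^+ 2 <=
    (1 - eps) / 2
      * Num.max (Num.sqrt (ber (absmx P ^+ 2))) (Num.sqrt (ber (absmx Q ^+ 2)))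
      * Num.max
          (ber (absmx P ^+ 2 + Q *m mpinv (absmx Q ^+ 2) *m Q^t*))
          (ber (absmx Q ^+ 2 + P *m mpinv (absmx P ^+ 2) *m P^t*))
    + eps * Num.max (ber (absmx P ^+ 2)) (ber (absmx Q ^+ 2)).
Proof.
have sq (T : 'M[R[i]]_n) : T^t* *m T = absmx T ^+ 2.
  by rewrite expr2; symmetry; exact: absmx_sqr.
have := ber_dsum_antidiag_le P Q eps01.
by rewrite /range_proj (sq P) (sq Q).
Qed.
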